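(* Let $G=(V,E)$ be a simple digraph with $n$ vertices. Then $G$ is a proper interval catch digraph if and only if there exists a vertex ordering $v_1,v_2,\ldots,v_n$ of $V$ with respect to which the augmented adjacency matrix $A^{*}(G)$ satisfies the following conditions: (1) in each row of $A^*(G)$ the $1$'s occur consecutively (with the columns in the order $v_1,\dots,v_n$); (2) for $i\neq j$, if $i_1<j_1$ then $i_2\le j_2$, where for $1\le i\le n$, $i_1$ and $i_2$ denote the first and the last column numbers containing a $1$ in the $i$-th row of $A^*(G)$.
   Context: Digraphs are finite and simple (no loops, no multiple arcs; both $uv$ and $vu$ may be arcs). A digraph $G=(V,E)$ is an interval catch digraph (ICD) if one can assign to each $u\in V$ a closed bounded interval $I_u$ of the real line and a point $p_u\in I_u$ such that for $u,v\in V$: $uv\in E$ if and only if $u\neq v$ and $p_v\in I_u$. It is a proper ICD if such an assignment exists in which no interval properly contains another. The augmented adjacency matrix $A^*(G)$ with respect to an ordering $v_1,\dots,v_n$ of $V$ is the $n\times n$ $(0,1)$-matrix, rows and columns both indexed in this order, whose $(i,j)$ entry is $1$ if and only if $i=j$ or $v_iv_j\in E$. *)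

(* Defs.v *)
From HB Require Import structures.
From mathcomp Require Import all_boot all_order all_algebra.
From mathcomp Require Import classical_sets set_interval reals.
Set Implicit Arguments.
Unset Strict Implicit.
Unset Printing Implicit Defensive.
Import Order.TTheory GRing.Theory Num.Theory.
Local Open Scope ring_scope.
Local Open Scope classical_set_scope.

Section IntervalCatchDigraphs.
Variables (R : realType) (V : finType) (E : rel V).

Definition closed_bounded_interval (J : set R) : Prop :=
  exists a b : R, a <= b /\ J = `[a, b].

Definition icd_representation (I : V -> set R) (p : V -> R) : Prop :=
  [/\ forall u, closed_bounded_interval (I u),
      forall u, I u (p u)
    & forall u v, E u v <-> u <> v /\ I u (p v)].

Definition interval_catch_digraph : Prop :=
  exists (I : V -> set R) (p : V -> R), icd_representation I p.

(* [`<`] is strict inclusion, so distinct vertices may share an interval. *)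
Definition proper_interval_catch_digraph : Prop :=
  exists (I : V -> set R) (p : V -> R),
    icd_representation I p /\ forall u v, ~ (I u `<` I v).

End IntervalCatchDigraphs.

Definition augmented_adjacency (V : finType) (E : rel V) (n : nat)
    (v : 'I_n -> V) : 'M[nat]_n :=
  \matrix_(i, j) (if (i == j) || E (v i) (v j) then 1%N else 0%N).

Definition consecutive_ones_rows (n : nat) (A : 'M[nat]_n) : Prop :=
  forall i j k l : 'I_n, (j <= k <= l)%N ->
    A i j = 1%N -> A i l = 1%N -> A i k = 1%N.

(* The column [i] serves as the witness that row [i] contains a 1: these are
   the first and last columns with a 1 as soon as [A i i = 1], which holds for
   every augmented adjacency matrix. *)
Definition first_one (n : nat) (A : 'M[nat]_n) (i : 'I_n) : 'I_n :=
  [arg min_(k < i | A i k == 1%N) (k : nat)]%N.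

Definition last_one (n : nat) (A : 'M[nat]_n) (i : 'I_n) : 'I_n :=
  [arg max_(k > i | A i k == 1%N) (k : nat)]%N.

(* Main.v *)
(** [E u z] or [u = z] holds exactly when [p z] lies in [I u]; so sorting the
    vertices by their points makes the ones of every row of the augmented
    adjacency matrix consecutive, and a smaller first column forces a smaller
    left endpoint, hence (properness) a right endpoint which is not larger.
    Conversely, number rows and columns from 0; if row [i] has its ones in the
    columns from [a] to [b], put the point of vertex [j] at [n (j + 1)] and let
    [I i = [n a + b + 1, n (b + 1) + a]]. Both endpoints encode the pair [(a, b)],
    with [a] dominant on the left and [b] dominant on the right, so condition (2)
    orders the left and the right endpoints in the same way. *)
Require Import Defs.
From mathcomp Require Import all_boot all_order all_algebra.
From mathcomp Require Import classical_sets set_interval reals.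
From mathcomp Require Import zify lra.
Set Implicit Arguments.
Unset Strict Implicit.
Unset Printing Implicit Defensive.
Import Order.TTheory GRing.Theory Num.Theory.

Lemma first_oneP (n : nat) (A : 'M[nat]_n) (i : 'I_n) : A i i = 1%N ->
  A i (first_one A i) = 1%N /\
  forall k, A i k = 1%N -> (first_one A i <= k)%N.
Proof.
move=> Aii; rewrite /first_one; case: arg_minnP => [|j /eqP Aij jmin].
  exact/eqP.
by split=> // k /eqP /jmin.
Qed.

Lemma last_oneP (n : nat) (A : 'M[nat]_n) (i : 'I_n) : A i i = 1%N ->
  A i (last_one A i) = 1%N /\
  forall k, A i k = 1%N -> (k <= last_one A i)%N.
Proof.
move=> Aii; rewrite /last_one; case: arg_maxnP => [|j /eqP Aij jmax].
  exact/eqP.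
by split=> // k /eqP /jmax.
Qed.

Lemma augmented_adjacency_diag (V : finType) (E : rel V) (n : nat)
    (v : 'I_n -> V) (i : 'I_n) : augmented_adjacency E v i i = 1%N.
Proof. by rewrite mxE eqxx. Qed.

Lemma augmented_adjacencyP (V : finType) (E : rel V) (n : nat)
    (v : 'I_n -> V) (i j : 'I_n) :
  augmented_adjacency E v i j = 1%N <-> i = j \/ E (v i) (v j).
Proof.
rewrite mxE; case: (eqVneq i j) => [->|ij] /=; first by split=> // _; left.
by case: (E _ _); split=> //; [move=> _; right | case=> // /eqP; rewrite (negPf ij)].
Qed.

(** This reduces each row to a pair of column numbers, the only data from which the converse builds
    its intervals. *)
Lemma consecutive_ones_rowsE (n : nat) (A : 'M[nat]_n) (i k : 'I_n) :
  consecutive_ones_rows A -> A i i = 1%N ->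
  A i k = 1%N <-> (first_one A i <= k <= last_one A i)%N.
Proof.
move=> consA Aii; have [fA fmin] := first_oneP Aii.
have [lA lmax] := last_oneP Aii; split=> [Aik|kfl]; last exact: consA kfl fA lA.
by rewrite fmin ?lmax.
Qed.

(** The diagonal ones match [p u] lying in [I u]; off the diagonal, injectivity of [v] supplies the
    distinctness that arcs require. *)
Lemma icd_augmented_adjacency (R : realType) (V : finType) (E : rel V) (n : nat)
    (I : V -> set R) (p : V -> R) (v : 'I_n -> V) (i j : 'I_n) :
  icd_representation E I p -> injective v ->
  augmented_adjacency E v i j = 1%N <-> I (v i) (p (v j)).
Proof.
move=> [_ Ip EI] vI; rewrite augmented_adjacencyP EI.
split=> [[->|[]]//|Iij]; have [->|/eqP ij] := eqVneq i j; first by left.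
by right; split=> // /vI.
Qed.

(** Distinct vertices may share a point, so the order obtained is only weakly monotone. *)
Lemma exists_sorting_bijection (R : realType) (V : finType) (p : V -> R) (n : nat) :
  #|V| = n -> exists v : 'I_n -> V,
    bijective v /\ forall i j : 'I_n, (i <= j)%N -> (p (v i) <= p (v j))%R.
Proof.
move=> cardV; pose leT (x y : V) := (p x <= p y)%R.
pose s := sort leT (enum V).
have ss : size s == n by rewrite size_sort -cardE cardV.
pose v (i : 'I_n) := tnth (Tuple ss) i; exists v; split.
  apply: inj_card_bij; last by rewrite card_ord cardV.
  by apply/tuple_uniqP; rewrite /= sort_uniq enum_uniq.
have leT_trans : transitive leT by move=> y x z; apply: le_trans.
have leT_refl : reflexive leT by move=> x; apply: lexx.
have s_sorted : sorted leT s by apply: sort_sorted => x y; apply: le_total.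
move=> i j ij; rewrite /v !(tnth_nth (v i)) /=.
by apply: (sorted_leq_nth leT_trans leT_refl _ s_sorted); rewrite ?inE ?(eqP ss).
Qed.

Lemma proper_icd_ordering (R : realType) (V : finType) (E : rel V) (n : nat) :
  #|V| = n -> proper_interval_catch_digraph R E ->
  exists v : 'I_n -> V,
    [/\ bijective v,
        consecutive_ones_rows (augmented_adjacency E v)
      & forall i j : 'I_n,
          (first_one (augmented_adjacency E v) i
             < first_one (augmented_adjacency E v) j)%N ->
          (last_one (augmented_adjacency E v) i
             <= last_one (augmented_adjacency E v) j)%N].
Proof.
move=> cardV [I [p [repI properI]]].
have [v [v_bij pv_mono]] := exists_sorting_bijection p cardV.
have AE i j := icd_augmented_adjacency i j repI (bij_inj v_bij).
have [I_itv _ _] := repI.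
exists v; split=> //.
  move=> i j k l /andP[jk kl] /AE Iij /AE Iil; apply/AE.
  move: Iij Iil; have [a [b [_ ->]]] := I_itv (v i).
  rewrite /= !in_itv /= => /andP[aj _] /andP[_ lb].
  by rewrite (le_trans aj (pv_mono _ _ jk)) (le_trans (pv_mono _ _ kl) lb).
move=> i j fij.
have [/AE fi _] := first_oneP (augmented_adjacency_diag E v i).
have [/AE li _] := last_oneP (augmented_adjacency_diag E v i).
have [/AE fj fjmin] := first_oneP (augmented_adjacency_diag E v j).
have [/AE lj ljmax] := last_oneP (augmented_adjacency_diag E v j).
(* Otherwise the points at the first and last columns of row [i] lie in [I (v i)] on either side of
   [I (v j)], which is then strictly included in [I (v i)]. *)
rewrite leqNgt; apply/negP => lji.
have pf := pv_mono _ _ (ltnW fij); have pl := pv_mono _ _ (ltnW lji).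
have nfi : ~ I (v j) (p (v (first_one (augmented_adjacency E v) i))).
  by move=> /AE /fjmin; rewrite leqNgt fij.
have nli : ~ I (v j) (p (v (last_one (augmented_adjacency E v) i))).
  by move=> /AE /ljmax; rewrite leqNgt lji.
apply: (properI (v j) (v i)); split; last by move=> /(_ _ fi).
move: fi li fj lj nfi nli.
have [a [b [_ ->]]] := I_itv (v i); have [c [d [_ ->]]] := I_itv (v j).
rewrite /= !in_itv /= => /andP[afi fib] /andP[ali lib] /andP[cfj fjd].
move=> /andP[clj ljd] /negP nfi /negP nli x.
rewrite /= !in_itv /= => /andP[cx xd].
(* This point is at most the one at the first column of row [j], hence at most [d]; being outside
   [[c, d]], it lies left of [c]. The other side is symmetric. *)
have fic : (p (v (first_one (augmented_adjacency E v) i)) < c)%R.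
  by move: nfi; rewrite (le_trans pf fjd) andbT -ltNge.
have dli : (d < p (v (last_one (augmented_adjacency E v) i)))%R.
  by move: nli; rewrite (le_trans clj pl) -ltNge.
by apply/andP; split; lra.
Qed.

Lemma ordering_proper_icd (R : realType) (V : finType) (E : rel V) (n : nat)
    (v : 'I_n -> V) :
  irreflexive E -> bijective v ->
  consecutive_ones_rows (augmented_adjacency E v) ->
  (forall i j : 'I_n, i != j ->
     (first_one (augmented_adjacency E v) i
        < first_one (augmented_adjacency E v) j)%N ->
     (last_one (augmented_adjacency E v) i
        <= last_one (augmented_adjacency E v) j)%N) ->
  proper_interval_catch_digraph R E.
Proof.
move=> Eirr [w vK wK] consA mono.
set A := augmented_adjacency E v in consA mono.
pose f u : nat := first_one A (w u); pose l u : nat := last_one A (w u).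
have fn u : (f u < n)%N by apply: ltn_ord.
have ln u : (l u < n)%N by apply: ltn_ord.
(* As [l u + 1 <= n], the left endpoint lies in [(n * f u, n * (f u + 1)]]; as [f u < n], the right
   one lies in [[n * (l u + 1), n * (l u + 2))]. So the multiples of [n] between them are exactly
   the points of the columns from [f u] to [l u]. *)
pose a u := (n * f u + l u + 1)%N; pose b u := (n * (l u + 1) + f u)%N.
pose q u := (n * (w u + 1))%N.
pose I u : set R := `[(a u)%:R%R, (b u)%:R%R]%classic.
pose p u : R := ((q u)%:R)%R.
have IE u z : I u (p z) <-> u = z \/ E u z.
  have -> : I u (p z) <-> (f u <= w z <= l u)%N.
    rewrite /I /p /= in_itv /= !ler_nat /a /b /q.
    have := fn u; have := ln u; move: (f u) (l u) (nat_of_ord (w z)) => x y j yn xn.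
    by split=> /andP[h1 h2]; apply/andP; split; nia.
  rewrite -(consecutive_ones_rowsE _ consA (augmented_adjacency_diag E v _)).
  rewrite augmented_adjacencyP !wK.
  by split=> -[e|]; [left; apply: (can_inj wK) | right | left; rewrite e | right].
have Iself u : I u (p u) by apply/IE; left.
have fl_mono u z : (f u < f z)%N -> (l u <= l z)%N.
  move=> fuz; apply: mono => //; apply/eqP => wuz.
  by move: fuz; rewrite /f wuz ltnn.
(* The interval is nonempty because it contains its own point. *)
have ab u : (a u <= b u)%N.
  by have := Iself u; rewrite /I /p /= in_itv /= !ler_nat => /andP[]; apply: leq_trans.
exists I, p; split.
  split=> // [u|u z].
    by exists (a u)%:R%R, (b u)%:R%R; rewrite ler_nat.
  split=> [Euz|[uz /IE[]//]].
  by split; [move=> uz; move: Euz; rewrite uz Eirr | apply/IE; right].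
(* Strict inclusion is refuted by showing that [I u] included in [I z] forces the two intervals to
   coincide. *)
move=> u z [Iuz]; apply.
have auz : (a z <= a u)%N.
  have /Iuz : I u (a u)%:R%R by rewrite /I /= in_itv /= !ler_nat leqnn ab.
  by rewrite /I /= in_itv /= !ler_nat => /andP[].
have buz : (b u <= b z)%N.
  have /Iuz : I u (b u)%:R%R by rewrite /I /= in_itv /= !ler_nat leqnn ab.
  by rewrite /I /= in_itv /= !ler_nat => /andP[].
(* The dominant terms give [f z <= f u] and [l u <= l z]. If [f z < f u], then [fl_mono] gives
   [l u = l z], and [buz] yields [f u <= f z], a contradiction. If [f z = f u], then [auz] yields
   [l z <= l u]. *)
have [fuz luz] : f u = f z /\ l u = l z.
  move: auz buz (fl_mono u z) (fl_mono z u) (fn u) (fn z) (ln u) (ln z).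
  rewrite /a /b; move: (f u) (f z) (l u) (l z) => x x' y y' H1 H2 H3 H4 H5 H6 H7 H8.
  have x'x : (x' <= x)%N by nia.
  have yy' : (y <= y')%N by nia.
  have [xx'|{}x'x] : x' = x \/ (x' < x)%N by lia.
    by subst x'; split=> //; lia.
  have y'y := H4 x'x.
  have e : y = y' by lia.
  by subst y'; split=> //; lia.
by rewrite /I /a /b fuz luz.
Qed.

Theorem theorem7p2 (R : realType) (V : finType) (E : rel V) (n : nat)
    (E_loopless : irreflexive E) (card_V : #|V| = n) :
  proper_interval_catch_digraph R E <->
  exists v : 'I_n -> V,
    [/\ bijective v,
        consecutive_ones_rows (augmented_adjacency E v)
      & forall i j : 'I_n, i != j ->
          (first_one (augmented_adjacency E v) i
             < first_one (augmented_adjacency E v) j)%N ->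
          (last_one (augmented_adjacency E v) i
             <= last_one (augmented_adjacency E v) j)%N].
Proof.
split=> [/(proper_icd_ordering card_V)[v [v_bij consA mono]]|].
  by exists v; split=> // i j _; apply: mono.
by move=> [v [v_bij consA mono]]; apply: ordering_proper_icd v_bij consA mono.
Qed.
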